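(* Let $m,k,s\in\mathbb{N}$ with $1\le k\le m-1$ and $\gcd(m,s)=1$, let $\Gamma=\langle m,m+s,\ldots,m+ks\rangle$, and let $S_{m,k}^s=S_\Gamma^s$ be the corresponding arithmetical Leamer monoid. Then the catenary degree of $S_{m,k}^s$ is $\left\lfloor\frac{m-2}{k}\right\rfloor+3$.
   Context: $\mathbb{N}$ contains $0$; $\langle\cdot\rangle$ denotes the additive submonoid of $\mathbb{N}$ generated by the listed elements. For a numerical monoid $\Gamma$ (additive submonoid of $\mathbb{N}$ with finite complement) and $s\in\mathbb{N}\setminus\Gamma$, the Leamer monoid is $$S_\Gamma^s=\{(0,0)\}\cup\{(x,n): n\ge 1,\ \{x,x+s,x+2s,\ldots,x+ns\}\subset\Gamma\}\subset\mathbb{N}^2,$$ a monoid under componentwise addition. An atom is a nonzero element that is not a sum of two nonzero elements of $S_\Gamma^s$. A factorization of an element is a finite multiset of atoms whose sum is that element; its length is its cardinality (with multiplicity). For two factorizations $z,z'$ of the same element, let $g$ be their multiset intersection; the distance is $d(z,z')=\max\{|z\setminus g|,|z'\setminus g|\}$ (multiset differences). The catenary degree of an element $a$ is the least $N\in\mathbb{N}$ such that any two factorizations $z,z'$ of $a$ can be joined by a finite chain $z=z_0,z_1,\ldots,z_t=z'$ of factorizations of $a$ with $d(z_{j-1},z_j)\le N$ for all $j$. The catenary degree of the monoid is the supremum of the catenary degrees of its elements. *)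

(* Defs.v *)
From HB Require Import structures.
From mathcomp Require Import all_boot all_order all_algebra.
From mathcomp Require Import finmap multiset.
From mathcomp Require Import boolp classical_sets.

Set Implicit Arguments.
Unset Strict Implicit.
Unset Printing Implicit Defensive.

Import GRing.Theory.

Local Open Scope classical_set_scope.

Definition submonoid (M : nmodType) (A : set M) : Prop :=
  A 0%R /\ forall x y : M, A x -> A y -> A (x + y)%R.

Definition submonoid_gen (M : nmodType) (G : set M) : set M :=
  smallest (@submonoid M) G.

Section Factorizations.
Local Open Scope mset_scope.
Variables (M : nmodType) (S : set M).

Definition atom (a : M) : Prop :=
  [/\ S a, a <> 0%R &
      forall x y : M, S x -> S y -> x <> 0%R -> y <> 0%R -> a <> (x + y)%R].

Definition factorization (a : M) (z : {mset M}) : Prop :=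
  (forall x : M, x \in z -> atom x) /\ (\sum_(x <- z) x)%R = a.

Definition fact_dist (z z' : {mset M}) : nat :=
  let g := z `&` z' in maxn (size (z `\` g)) (size (z' `\` g)).

(* The chain is z :: p, so z_1, ..., z_t are the items of p. *)
Definition chain_connected (a : M) (N : nat) (z z' : {mset M}) : Prop :=
  exists p : seq {mset M},
    [/\ forall y : {mset M}, y \in p -> factorization a y,
        path (fun y y' => fact_dist y y' <= N) z p & last z p = z'].

Definition all_chain_connected (a : M) (N : nat) : Prop :=
  forall z z' : {mset M},
    factorization a z -> factorization a z' -> chain_connected a N z z'.

Definition elt_catenary_degree (a : M) (c : nat) : Prop :=
  all_chain_connected a c /\
  forall N : nat, all_chain_connected a N -> c <= N.

(* An element without a finite catenary degree has no upper bound: it counts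
   as infinite in the supremum. *)
Definition catenary_ubound (b : nat) : Prop :=
  forall a : M, S a -> exists2 c : nat, elt_catenary_degree a c & c <= b.

(* "The supremum of the catenary degrees of the elements of S is c." *)
Definition catenary_degree (c : nat) : Prop :=
  catenary_ubound c /\ forall b : nat, catenary_ubound b -> c <= b.

End Factorizations.

Definition leamer (Gamma : set nat) (s : nat) : set (nat * nat) :=
  [set p | p = (0, 0) \/
           (1 <= p.2 /\ forall i : nat, i <= p.2 -> Gamma (p.1 + i * s))].

Definition arith_monoid (m k s : nat) : set nat :=
  submonoid_gen [set m + i * s | i in [set i | i <= k]].

Definition arith_leamer (m k s : nat) : set (nat * nat) :=
  leamer (arith_monoid m k s) s.

(* Main.v *)
(* Let q = floor((m - 2) / k) + 1, the least q with k q >= m - 1. Every x in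
   Gamma is uniquely a m + b s with 0 <= b < m, and a is then the largest
   coefficient of m in any expression of x; call it the degree of x. Columns
   of the Leamer monoid of degree at least q are infinite, while a column
   (a, b) of degree a < q contains exactly the heights n with b + n <= k a.

   Upper bound: a sum (x, n) of q + 2 atoms has degree A >= q + 2. With b the
   canonical s-coefficient of x, it equals ((A - q) m, 1) + (q m + b s, n - 1),
   whose second term has degree q and so only factorizations of length at most
   q. Thus any q + 2 atoms can be replaced by at most q + 1 atoms, and every
   factorization is linked to one of length at most q + 2 by steps of size at
   most q + 2; any two such short factorizations are within distance q + 2.

   Lower bound: the element ((q + 2) m, k q + 2) has factorizations of length
   at most 2 and of length q + 2, but none of length strictly in between. *)
Require Import Defs.
From mathcomp Require Import all_boot all_order all_algebra.
From mathcomp Require Import finmap multiset.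
From mathcomp Require Import boolp classical_sets.
From mathcomp Require Import zify.

Set Implicit Arguments.
Unset Strict Implicit.
Unset Printing Implicit Defensive.

Import GRing.Theory.

(** * Sizes of multisets and sums over them *)

Section MultisetSize.
Local Open Scope mset_scope.
Variable K : choiceType.
Implicit Types A B : {mset K}.

Lemma seq_mset_cat (s t : seq K) : seq_mset (s ++ t) = seq_mset s `+` seq_mset t.
Proof. by apply/msetP => x; rewrite msetE2 !mset_seqE count_cat. Qed.

Lemma size_seq_mset (s : seq K) : size (seq_mset s) = size s.
Proof. exact: perm_size (perm_eq_seq_mset s). Qed.

Lemma perm_msetD A B : perm_eq (A `+` B) (A ++ B).
Proof.
rewrite -{1}(seq_mset_id A) -{1}(seq_mset_id B) -seq_mset_cat.
exact: perm_eq_seq_mset.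
Qed.

Lemma size_msetD A B : size (A `+` B) = size A + size B.
Proof. by rewrite (perm_size (perm_msetD A B)) size_cat. Qed.

Lemma size_msetB_le A B : size (A `\` B) <= size A.
Proof.
have := size_msetD (A `\` B) (A `\` (A `\` B)).
rewrite msetBDKC; last exact: msubsetDl.
by move=> ->; apply: leq_addr.
Qed.

Lemma big_msetD (R : Type) (idx : R) (op : Monoid.com_law idx) A B (F : K -> R) :
  \big[op/idx]_(x <- A `+` B) F x =
  op (\big[op/idx]_(x <- A) F x) (\big[op/idx]_(x <- B) F x).
Proof. by rewrite (perm_big _ (perm_msetD A B)) big_cat. Qed.

End MultisetSize.

(** * Chains of factorizations in a general monoid *)

Section CatenaryDegree.
Local Open Scope mset_scope.
Variables (M : nmodType) (S : set M).
Implicit Types (a : M) (z g u : {mset M}) (l : seq M).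

Lemma factorization_seq a l :
  (forall x, x \in l -> atom S x) -> (\sum_(x <- l) x)%R = a ->
  factorization S a (seq_mset l).
Proof.
move=> Hl <-; split; last by rewrite (perm_big _ (perm_eq_seq_mset l)).
by move=> x; rewrite (perm_mem (perm_eq_seq_mset l)); apply: Hl.
Qed.

Lemma fact_dist_le z z' : fact_dist z z' <= maxn (size z) (size z').
Proof.
rewrite /fact_dist /= geq_max !leq_max !size_msetB_le.
by rewrite orbT.
Qed.

Lemma fact_distC z z' : fact_dist z z' = fact_dist z' z.
Proof. by rewrite /fact_dist /= maxnC msetIC. Qed.

Lemma fact_distD2l g u u' : fact_dist (g `+` u) (g `+` u') = fact_dist u u'.
Proof. by rewrite /fact_dist /= -msetDIr !msetBDl. Qed.

Lemma chain_connected_step a N z z' :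
  factorization S a z' -> fact_dist z z' <= N -> chain_connected S a N z z'.
Proof.
move=> Hz' Hd; exists [:: z']; split=> //=; last by rewrite Hd.
by move=> y; rewrite inE => /eqP ->.
Qed.

Lemma chain_connected_trans a N z1 z2 z3 :
  chain_connected S a N z1 z2 -> chain_connected S a N z2 z3 ->
  chain_connected S a N z1 z3.
Proof.
move=> [p [Hp pp lp]] [r [Hr pr lr]]; exists (p ++ r); split.
- by move=> y; rewrite mem_cat => /orP[/Hp|/Hr].
- by rewrite cat_path pp lp.
- by rewrite last_cat lp.
Qed.

Lemma chain_connected_sym a N z z' :
  factorization S a z -> chain_connected S a N z z' ->
  chain_connected S a N z' z.
Proof.
move=> + [p [Hp pp <-]]; elim: p z Hp pp => [|y p IH] z Hp /= pp Hz.
  by exists [::].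
have Hy : factorization S a y by apply: Hp; rewrite mem_head.
case/andP: pp => dzy pp; apply: (@chain_connected_trans _ _ _ y).
  by apply: IH => // t tp; apply: Hp; rewrite inE tp orbT.
by apply: chain_connected_step; rewrite // fact_distC.
Qed.

(** Trading [N] atoms for fewer while the others stay fixed is a step of distance at most [N], and
    it lowers the size. Iteration ends at size at most [N]. *)
Lemma all_chain_connected_shorten N :
  (forall l, size l = N -> (forall x, x \in l -> atom S x) ->
    exists2 l', factorization S (\sum_(x <- l) x)%R (seq_mset l') & size l' < N) ->
  forall a, all_chain_connected S a N.
Proof.
move=> Hshort a.
have reduce z : factorization S a z ->
    exists z', [/\ factorization S a z', size z' <= N & chain_connected S a N z z'].
  elim: {z}(size z) {-2}z (leqnn (size z)) => [|n IH] z szn Hz.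
    exists z; split=> //; last by exists [::].
    by move: szn; rewrite leqn0 => /eqP ->.
  have [szN|szN] := leqP (size z) N.
    by exists z; split=> //; exists [::].
  have ztd : z = seq_mset (drop N z) `+` seq_mset (take N z).
    by rewrite msetDC -seq_mset_cat cat_take_drop seq_mset_id.
  have sl : size (take N z) = N by rewrite size_takel // ltnW.
  have atl x : x \in take N z -> atom S x by move/mem_take; apply: Hz.1.
  have [l' Hl' sl'] := Hshort _ sl atl.
  pose z1 := seq_mset (drop N z) `+` seq_mset l'.
  have Hz1 : factorization S a z1.
    split.
      move=> x; rewrite in_msetD => /orP[|/Hl'.1 //].
      by rewrite (perm_mem (perm_eq_seq_mset _)) => /mem_drop; apply: Hz.1.
    rewrite /z1 big_msetD /= Hl'.2 -[RHS]Hz.2 [in RHS]ztd big_msetD /=.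
    by rewrite (perm_big _ (perm_eq_seq_mset (take N z))).
  have sz1 : size z1 <= n.
    rewrite /z1 size_msetD !size_seq_mset size_drop; lia.
  have [z' [Hz' sz' cz']] := IH z1 sz1 Hz1.
  exists z'; split=> //; apply: chain_connected_trans cz'.
  apply: chain_connected_step => //.
  rewrite {1}ztd fact_distD2l; apply: leq_trans (fact_dist_le _ _) _.
  rewrite !size_seq_mset; lia.
move=> z z' Hz Hz'.
have [y [Hy sy cy]] := reduce z Hz; have [y' [Hy' sy' cy']] := reduce z' Hz'.
apply: chain_connected_trans cy _.
apply: chain_connected_trans (chain_connected_sym Hz' cy').
apply: chain_connected_step => //.
by apply: leq_trans (fact_dist_le _ _) _; rewrite geq_max sy.
Qed.

Lemma elt_catenary_degree_exists a N :
  all_chain_connected S a N -> exists2 c, elt_catenary_degree S a c & c <= N.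
Proof.
move=> HN; pose P n := `[< all_chain_connected S a n >].
have exP : exists n, P n by exists N; apply/asboolP.
case: (ex_minnP exP) => c /asboolP Hc minc; exists c.
  by split=> // n /asboolP; apply: minc.
exact/minc/asboolP.
Qed.

(** * Lower bounds in a reduced cancellative monoid *)

Hypothesis SD : forall x y, S x -> S y -> S (x + y)%R.
Hypothesis S_add_eq0 : forall x y, S x -> S y -> (x + y)%R = 0%R -> x = 0%R.
Hypothesis addIl : forall x : M, injective (+%R x).

Lemma sum_atoms_neq0 l : l != [::] -> (forall x, x \in l -> atom S x) ->
  S (\sum_(x <- l) x)%R /\ (\sum_(x <- l) x)%R <> 0%R.
Proof.
elim: l => // x l IH _ Hl.
have [Sx x0 _] : atom S x by apply: Hl; rewrite mem_head.
rewrite big_cons; case: l IH Hl => [|y l] IH Hl; first by rewrite big_nil addr0.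
have [//|z zl|Sl l0] := IH _; first by apply: Hl; rewrite inE zl orbT.
by split; [exact: SD | move/S_add_eq0 => /(_ Sx Sl)].
Qed.

(* If the two factorizations shared an atom, cancelling it would leave at most
   one atom on the short side, equal to a sum of at least two. *)
Lemma fact_dist_length2 a z z' :
  factorization S a z -> factorization S a z' ->
  2 < size z -> size z' <= 2 -> size z <= fact_dist z z'.
Proof.
move=> Hz Hz' sz sz'; rewrite /fact_dist /=; set g := z `&` z'.
have zg : g `+` (z `\` g) = z by rewrite msetBDKC // msubsetIl.
have zg' : g `+` (z' `\` g) = z' by rewrite msetBDKC // msubsetIr.
have [g0|gn0] := eqVneq g mset0; first by rewrite g0 !msetB0 leq_maxl.
have sg : 0 < size g by rewrite lt0n size_mset_eq0.
have szg : size g + size (z `\` g) = size z by rewrite -size_msetD zg.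
have szg' : size g + size (z' `\` g) = size z' by rewrite -size_msetD zg'.
have at1 x : x \in enum_mset (z `\` g) -> atom S x.
  by move=> xz; apply: Hz.1; rewrite -zg in_msetD; apply/orP; right.
have at2 x : x \in enum_mset (z' `\` g) -> atom S x.
  by move=> xz; apply: Hz'.1; rewrite -zg' in_msetD; apply/orP; right.
have E : (\sum_(x <- z `\` g) x = \sum_(x <- z' `\` g) x)%R.
  apply: (@addIl (\sum_(x <- g) x)%R).
  by rewrite -!big_msetD zg zg' Hz.2 Hz'.2.
move: szg szg' at1 at2 E.
case: (enum_mset (z `\` g)) => [|x l] szg szg' at1 at2 E /=.
  by rewrite /= in sz sz' szg szg'; lia.
case: (enum_mset (z' `\` g)) szg' at2 E =>
  [|y [|y' l']] szg' at2 E /=;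
  rewrite /= in sz sz' sg szg szg'.
- by have [] := @sum_atoms_neq0 (x :: l) isT at1; rewrite E big_nil.
- have ln : l != [::] by case: l szg {at1 E} => //=; lia.
  have atl v : v \in l -> atom S v by move=> vl; apply: at1; rewrite inE vl orbT.
  have [Sl l0] := sum_atoms_neq0 ln atl.
  have [Sx x0 _] := at1 x (mem_head _ _).
  have [_ _ /(_ _ _ Sx Sl x0 l0)] := at2 y (mem_head _ _).
  by rewrite big_cons big_seq1 in E; rewrite E.
- lia.
Qed.

(** The first step of the chain that drops below size [L] lands, by the gap, at size at most 2. By
    [fact_dist_length2] this step costs the full size it starts from. *)
Lemma catenary_lower_bound a N L z z' :
  factorization S a z -> L <= size z -> 2 < L ->
  factorization S a z' -> size z' < L ->
  (forall y, factorization S a y -> 2 < size y -> L <= size y) ->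
  all_chain_connected S a N -> L <= N.
Proof.
move=> Hz Lz L2 Hz' z'L gap /(_ z z' Hz Hz') [p [Hp pp lp]].
elim: p z Hz Lz Hp pp lp => [|y p IH] z Hz Lz Hp /= pp lp.
  by move: z'L; rewrite -lp ltnNge Lz.
have Hy : factorization S a y by apply: Hp; rewrite mem_head.
case/andP: pp => dzy pp.
have [yL|Ly] := ltnP (size y) L; last first.
  by apply: (IH y) => // t tp; apply: Hp; rewrite inE tp orbT.
have y2 : size y <= 2.
  by rewrite leqNgt; apply/negP => /(gap _ Hy); rewrite leqNgt yL.
apply: (leq_trans Lz); apply: leq_trans dzy.
exact: (fact_dist_length2 Hz Hy (leq_trans L2 Lz) y2).
Qed.

End CatenaryDegree.

(** * Canonical representations in the arithmetical monoid *)

Section ArithmeticalLeamer.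
Variables (m k s q : nat).
Hypotheses (hk : 1 <= k) (hkm : k <= m - 1) (hms : gcdn m s = 1).
(* [q] is the least natural number with [m - 1 <= k * q]. *)
Hypotheses (q_ge : m <= k * q + 1) (q_min : forall a, a < q -> k * a + 2 <= m).

Local Notation G := (arith_monoid m k s).
Local Notation S := (arith_leamer m k s).

Lemma m_gt1 : 1 < m. Proof. lia. Qed.

Lemma q_gt0 : 0 < q. Proof. have := m_gt1; nia. Qed.

Lemma s_gt0 : 0 < s.
Proof. by move: hms; case: (s) => // /[!gcdn0] E; have := m_gt1; rewrite E. Qed.

Lemma arith_monoidP x :
  G x <-> exists a b, x = a * m + b * s /\ b <= k * a.
Proof.
split.
  move=> /(_ [set x | exists a b, x = a * m + b * s /\ b <= k * a]%classic); apply.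
  split; first split.
  - by exists 0, 0; rewrite muln0.
  - move=> _ _ [a [b [-> Hb]]] [c [d [-> Hd]]]; exists (a + c), (b + d).
    split; last lia.
    by rewrite /GRing.add /=; lia.
  - by move=> _ [i /= ik <-]; exists 1, i; split; lia.
case=> a [b [-> Hb]] A [[A0 AD] AG].
elim: a b Hb => [|a IH] b Hb.
  have -> : b = 0 by lia.
  exact: A0.
(* Peel off one generator, with as large a multiple of [s] as possible. *)
have -> : a.+1 * m + b * s =
    (m + minn b k * s) + (a * m + (b - minn b k) * s) by nia.
apply: AD; last by apply: IH; lia.
by apply: AG; exists (minn b k) => //=; lia.
Qed.

(** Coprimality makes [m] divide the difference of the [s]-coefficients. As only [b] is reduced, the
    other side can differ only by trading [j * s] copies of [m] for [j * m] copies of [s]; so [a] is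
    the largest [m]-coefficient. *)
Lemma arith_rep_uniq a b a' b' : b < m -> a * m + b * s = a' * m + b' * s ->
  exists j, a = a' + j * s /\ b' = b + j * m.
Proof.
move=> bm E; have m0 := m_gt1.
have [bb'|b'b] := leqP b b'.
  have D : m %| (b' - b) * s.
    have -> : (b' - b) * s = (a - a') * m by nia.
    exact: dvdn_mull.
  rewrite Gauss_dvdl in D; last by rewrite /coprime hms.
  case/dvdnP: D => j Ej; exists j; split; last lia.
  have : a * m = (a' + j * s) * m by nia.
  by move/eqP; rewrite eqn_pmul2r; [move/eqP | lia].
have D : m %| (b - b') * s.
  have -> : (b - b') * s = (a' - a) * m by nia.
  exact: dvdn_mull.
rewrite Gauss_dvdl in D; last by rewrite /coprime hms.
have b0 : 0 < b - b' by lia.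
have := dvdn_leq b0 D; lia.
Qed.

Lemma arith_rep_reduce a b :
  exists a' b', [/\ a * m + b * s = a' * m + b' * s, b' < m, a <= a' & b' <= b].
Proof.
have rm : b %% m < m by rewrite ltn_mod; have := m_gt1; lia.
move: (divn_eq b m) rm; move: (b %/ m) (b %% m) => c r -> rm.
by exists (a + c * s), r; split; nia.
Qed.

Lemma arith_monoid_canon x : G x ->
  exists a b, [/\ x = a * m + b * s, b < m & b <= k * a].
Proof.
move/arith_monoidP => [a [b [-> ba]]].
by have [a' [b' [-> ? ? ?]]] := arith_rep_reduce a b; exists a', b'; split=> //; nia.
Qed.

Lemma arith_monoid_rep a b : b < m -> G (a * m + b * s) -> b <= k * a.
Proof.
move=> bm /arith_monoidP[a' [b' [E b'a']]].
by have [j [-> Eb]] := arith_rep_uniq bm E; nia.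
Qed.

Lemma arith_monoid_large a b : q <= a -> G (a * m + b * s).
Proof.
move=> qa; have [a' [b' [-> bm aa' _]]] := arith_rep_reduce a b.
apply/arith_monoidP; exists a', b'; split=> //.
(* [b' <= m - 1 <= k * q <= k * a']. *)
nia.
Qed.

(** * Columns of the Leamer monoid and existence of factorizations *)

Lemma leamer_large a b n : q <= a -> 0 < n -> S (a * m + b * s, n).
Proof.
move=> qa n0; right; split=> //= i _.
by rewrite -addnA -mulnDl; apply: arith_monoid_large.
Qed.

Lemma leamer_interval a b n : 0 < n -> b + n <= k * a -> S (a * m + b * s, n).
Proof.
move=> n0 bn; right; split=> //= i ilen.
by rewrite -addnA -mulnDl; apply/arith_monoidP; exists a, (b + i); split=> //; lia.
Qed.

Lemma leamer_canon x n : S (x, n) -> (x, n) <> (0, 0) ->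
  exists a b, [/\ x = a * m + b * s, b < m, 0 < a, 0 < n &
    q <= a \/ b + n <= k * a].
Proof.
move=> [//|/= [n0 H]] _.
have Hx : G x by have := H 0 isT; rewrite mul0n addn0.
have [a [b [Ex bm ba]]] := arith_monoid_canon Hx.
have [qa|aq] := leqP q a.
  by exists a, b; split=> //; [apply: leq_trans q_gt0 qa | left].
(* Below degree [q] there is no wrap-around modulo [m]: from [b + i <= k * a] and [k * a + 2 <= m],
   the next coefficient is still below [m], so its representation is canonical. *)
have small i : i <= n -> b + i <= k * a.
  elim: i => [|i IH] ilen; first by rewrite addn0.
  apply: arith_monoid_rep.
    by have := q_min aq; have := IH (ltnW ilen); lia.
  by have := H _ ilen; rewrite Ex -addnA -mulnDl.
have := small _ (leqnn n) => bn.
exists a, b; split=> //; last by right.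
by case: (a) bn => // /[!muln0]; lia.
Qed.

Lemma leamerD x y : S x -> S y -> S (x + y)%R.
Proof.
case: x y => [x n] [y p].
move=> [[-> ->]|/= [n0 Hx]]; first by rewrite add0r.
move=> [[-> ->]|/= [p0 Hy]]; first by rewrite addr0; right.
right; split=> /=; first by rewrite /GRing.add /=; lia.
move=> i; rewrite {1 2}/GRing.add /= => inp.
(* Of the [i] steps, the first column takes as many as its height allows and the second takes the
   rest. *)
have -> : x + y + i * s = (x + minn i n * s) + (y + (i - minn i n) * s) by nia.
have /arith_monoidP[a [b [-> ab]]] : G (x + minn i n * s) by apply: Hx; lia.
have /arith_monoidP[c [d [-> cd]]] : G (y + (i - minn i n) * s) by apply: Hy; lia.
by apply/arith_monoidP; exists (a + c), (b + d); split; lia.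
Qed.

Lemma pair_add_eq0 (x y : nat * nat) : (x + y)%R = 0%R -> x = 0%R.
Proof.
case: x y => [x n] [y p] [/eqP + /eqP]; rewrite !addn_eq0.
by move=> /andP[/eqP-> _] /andP[/eqP-> _].
Qed.

Lemma pair_addI (x : nat * nat) : injective (+%R x).
Proof. by case: x => [x n] [y p] [y' p'] [/addnI -> /addnI ->]. Qed.

(** Nonzero elements have positive height, so both terms of a splitting have smaller height than the
    sum. *)
Lemma leamer_factorization x : S x ->
  exists l : seq (nat * nat), (forall y, y \in l -> atom S y) /\ (\sum_(y <- l) y)%R = x.
Proof.
elim: {x}x.2 {-2}x (leqnn x.2) => [|n IH] x xn Sx.
  exists [::]; split=> //; rewrite big_nil; case: Sx => [-> //|[]]; lia.
have [Ax|nAx] := pselect (atom S x).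
  by exists [:: x]; split; rewrite ?big_seq1 // => y; rewrite inE => /eqP ->.
have [->|x0] := eqVneq x 0%R; first by exists [::]; rewrite big_nil.
have [y [z [Sy Sz y0 z0 Exyz]]] : exists y z,
    [/\ S y, S z, y <> 0%R, z <> 0%R & x = (y + z)%R].
  apply: contrapT => H; apply: nAx; split=> //; first exact/eqP.
  by move=> y z Sy Sz y0 z0 E; apply: H; exists y, z.
have pos v : S v -> v <> 0%R -> 0 < v.2 by case=> [-> //|[]].
have := pos _ Sy y0; have := pos _ Sz z0.
have E2 : x.2 = y.2 + z.2 by rewrite Exyz.
move=> y2 z2; have [|//|ly [aty Ey]] := IH y; first lia.
have [|//|lz [atz Ez]] := IH z; first lia.
exists (ly ++ lz); split; last by rewrite big_cat /= Ey Ez Exyz.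
by move=> v; rewrite mem_cat => /orP[/aty|/atz].
Qed.

Lemma atom_height1 x : S (x, 1) -> atom S (x, 1).
Proof.
move=> Sx; split=> // [[y n] [z p]].
move=> [[-> ->] //|[/= n0 _]] [[-> ->] //|[/= p0 _]] _ _ [].
by rewrite /GRing.add /=; lia.
Qed.

Lemma leamer_fst_ge x : S x -> x <> 0%R -> m <= x.1.
Proof. by case: x => x n Sx /(leamer_canon Sx) [a [b [-> /= _ a0 _ _]]]; nia. Qed.

Lemma atom_degree1 n : 0 < n -> n <= k -> atom S (m, n).
Proof.
move=> n0 nk; split.
- by have := @leamer_interval 1 0 n n0; rewrite mul1n addn0 muln1; apply.
- by case; have := m_gt1; lia.
- move=> [x p] [y r] Sx Sy x0 y0 [+ _].
  have := leamer_fst_ge Sx x0; have := leamer_fst_ge Sy y0; have := m_gt1.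
  rewrite /GRing.add /=; lia.
Qed.

Lemma sum_pairE (l : seq (nat * nat)) :
  (\sum_(x <- l) x)%R = (\sum_(x <- l) x.1, \sum_(x <- l) x.2).
Proof. by elim: l => [|x l IH]; rewrite ?big_nil // !big_cons IH. Qed.

(** Every atom contributes at least 1 to the degree and at least 1 to the height. *)
Lemma sum_atoms_rep (l : seq (nat * nat)) : (forall x, x \in l -> atom S x) ->
  exists A B, \sum_(x <- l) x.1 = A * m + B * s /\
    (size l <= A /\ size l <= \sum_(x <- l) x.2).
Proof.
elim: l => [|[x n] l IH] Hl; first by exists 0, 0; rewrite !big_nil.
have [|A [B [EA [lA ln]]]] := IH.
  by move=> y yl; apply: Hl; rewrite inE yl orbT.
have [Sx x0 _] := Hl _ (mem_head _ _).
have [a [b [Ex bm a0 n0 _]]] := leamer_canon Sx x0.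
exists (a + A), (b + B); rewrite !big_cons EA /= Ex; split; [nia | lia].
Qed.

(** * The upper bound *)

Lemma leamer_shorten (l : seq (nat * nat)) : size l = q + 2 -> (forall x, x \in l -> atom S x) ->
  exists2 l', factorization S (\sum_(x <- l) x)%R (seq_mset l') & size l' < q + 2.
Proof.
move=> sl Hl; have [A [B [EA [lA ln]]]] := sum_atoms_rep Hl.
have [A' [B' [EA' bm AA' _]]] := arith_rep_reduce A B.
have n2 : 0 < (\sum_(x <- l) x.2).-1 by lia.
have [t [att Et]] := leamer_factorization (leamer_large B' (leqnn q) n2).
(* The canonical degree [q] bounds the [m]-coefficient of every representation, hence the number of
   atoms. *)
have st : size t <= q.
  have [C [D [EC [tC _]]]] := sum_atoms_rep att.
  rewrite sum_pairE in Et; case: Et => Et _; rewrite Et in EC.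
  by have [j [-> _]] := arith_rep_uniq bm EC; lia.
exists (((A' - q) * m, 1) :: t); last by rewrite /=; lia.
apply: factorization_seq.
  move=> x; rewrite inE => /orP[/eqP ->|/att //].
  apply: atom_height1; rewrite -[(A' - q) * m]addn0 -[X in _ + X](mul0n s).
  by apply: leamer_interval => //; nia.
rewrite big_cons Et sum_pairE EA EA'; congr pair; rewrite /= /GRing.add /=; nia.
Qed.

(** * Classification of the atoms *)

Lemma atom_split a b n : 1 < n -> 1 < a -> b + n <= k * a ->
  ~ atom S (a * m + b * s, n).
Proof.
move=> n2 a2 bn [_ _].
(* Split off an element of degree 1: [b1] leaves it room for height at least 1, and [h] fills that
   room but keeps height at least 1 for the other term. *)
pose b1 := minn b (k - 1); pose h := minn (k - b1) (n - 1).
have Sx : S (1 * m + b1 * s, h) by apply: leamer_interval; lia.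
have Sy : S ((a - 1) * m + (b - b1) * s, n - h) by apply: leamer_interval; nia.
move=> /(_ _ _ Sx Sy); apply.
- by case; have := m_gt1; nia.
- by case; have := m_gt1; nia.
- by congr pair; rewrite /= /GRing.add /=; nia.
Qed.

(** Consider height at least 2 and degree at least 2. Under the bound [k * a], [atom_split] applies;
    above it the degree is at least [q], and if it exceeds [q] then removing [(m, 1)] leaves an
    element of an infinite column. *)
Lemma atom_canon x n : atom S (x, n) ->
  exists a b, [/\ x = a * m + b * s, b < m, 0 < a, 0 < n &
    [\/ a = 1 /\ b + n <= k, 1 < a /\ n = 1 | a = q /\ k * q < b + n]].
Proof.
move=> At; have [Sx x0 At'] := At.
have [a [b [Ex bm a0 n0 Hab]]] := leamer_canon Sx x0.
exists a, b; split=> //.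
have [n1|n1] := eqVneq n 1.
  have [a1|] := leqP a 1; last by constructor 2.
  have {a1}a1 : a = 1 by lia.
  have [?|?] := leqP (b + n) k; first by constructor 1.
  (* A column of degree 1 can exceed the bound [k] only if it is infinite, that is, if [q = 1]. *)
  constructor 3; have -> : q = 1 by have := q_gt0; case: Hab; subst a; lia.
  by rewrite muln1.
have [bn|bn] := leqP (b + n) (k * a).
  have [a1|a1] := leqP a 1; first by constructor 1; nia.
  by case: (@atom_split a b n) => //; [lia | rewrite -Ex].
have [qa|aq|aq] := ltngtP q a; last by constructor 3; rewrite aq.
- case: (At' (m, 1) ((a - 1) * m + b * s, n - 1)).
  + by have [] := @atom_degree1 1 isT hk.
  + by apply: leamer_large; lia.
  + by [].
  + by case; lia.
  + by rewrite Ex; congr pair; rewrite /= /GRing.add /=; nia.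
- lia.
Qed.

(* [size l < A] means that some atom has degree at least 2, hence height 1. *)
Lemma small_atoms_height (l : seq (nat * nat)) :
  (forall x, x \in l -> exists a b, [/\ x.1 = a * m + b * s, 0 < a, 0 < x.2 &
     (a = 1 /\ b + x.2 <= k) \/ (1 < a /\ x.2 = 1)]) ->
  exists A B, \sum_(x <- l) x.1 = A * m + B * s /\
    [/\ size l <= A, \sum_(x <- l) x.2 <= k * A,
        size l = A -> B + \sum_(x <- l) x.2 <= k * A &
        size l < A -> \sum_(x <- l) x.2 + 2 * k <= k * A + 1].
Proof.
elim: l => [|[x n] l IH] Hl; first by exists 0, 0; rewrite !big_nil; split.
have [|A [B [EA [H1 H2 H3 H4]]]] := IH.
  by move=> y yl; apply: Hl; rewrite inE yl orbT.
have [a [b [/= Ex a0 n0 Hab]]] := Hl _ (mem_head _ _).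
exists (a + A), (b + B); rewrite !big_cons EA /= Ex; split; first nia.
set N := \sum_(x <- l) x.2 in H2 H3 H4 *.
(* An atom of degree at least 2 and height 1 falls short of [k] times its degree by at least
   [2 * k - 1]; no atom here exceeds [k] times its degree. *)
case: Hab => [[-> bn]|[a2 ->]]; split; try lia; try nia.
Qed.

(** * The witness and the lower bound *)

Lemma witness_lengths z :
  factorization S ((q + 2) * m, k * q + 2) z -> 2 < size z -> q + 2 <= size z.
Proof.
case=> Hz; rewrite sum_pairE.
have {Hz} : forall x : nat * nat, x \in enum_mset z -> atom S x := Hz.
move: (enum_mset z : seq (nat * nat)) => l Hl [/= E1 E2] /= sl.
have m0 : 0 < m by have := m_gt1; lia.
have s0 := s_gt0.
pose big (x : nat * nat) := exists a b,
  [/\ x.1 = a * m + b * s, a = q & k * q < b + x.2].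
have [[[x n] xl [a [b [/= Ex aq bx]]]]|nobig] := pselect (exists2 x : nat * nat, x \in l & big x).
  have pl := perm_to_rem xl; have sr := size_rem xl.
  move: (rem _ _ : seq (nat * nat)) pl sr => r pl sr.
  have atr y : y \in r -> atom S y.
    by move=> yr; apply: Hl; rewrite (perm_mem pl) inE yr orbT.
  have [A [B [EA [rA rn]]]] := sum_atoms_rep atr.
  have {}E1 : a * m + b * s + \sum_(y <- r) y.1 = (q + 2) * m.
    by rewrite -E1 (perm_big _ pl) big_cons -Ex.
  have {}E2 : n + \sum_(y <- r) y.2 = k * q + 2.
    by rewrite -E2 (perm_big _ pl) big_cons.
  have EE : (q + 2) * m + 0 * s = (q + A) * m + (b + B) * s.
    by rewrite EA in E1; subst a; nia.
  (* Beside an atom of degree [q] there is degree at most 2 left, so exactly two other atoms. This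
     forces [j = 0] and [b = 0], so the big atom has height above [k * q], leaving less than 2 for
     the other two. *)
  have [j [Ej Bj]] := arith_rep_uniq m0 EE.
  have [j0|j0] := posnP j; last first.
    have js : s <= j * s by rewrite leq_pmull.
    by move: sr rA sl Ej s0 js => /=; clear; lia.
  by move: sr rA rn sl E2 bx Ej Bj; rewrite j0 /=; clear; lia.
have [|A [B [EA [H1 H2 H3 H4]]]] := @small_atoms_height l.
  move=> [x n] xl; have [a [b [Ex bm a0 n0 Hab]]] := atom_canon (Hl _ xl).
  exists a, b; split=> //; case: Hab => [|?|[aq ?]]; [by left | by right |].
  by case: nobig; exists (x, n) => //; exists a, b.
rewrite E2 in H2 H3 H4; rewrite E1 in EA.
have EE : (q + 2) * m + 0 * s = A * m + B * s by lia.
have [j [Ej Bj]] := arith_rep_uniq m0 EE.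
(* The witness has height only [2 * k - 2] below [k * (q + 2)], so the deficit [2 * k - 1] of an
   atom of degree at least 2 is too large. *)
have [lA|lA] := ltnP (size l) A; first by have := H4 lA; nia.
have eA : size l = A by lia.
(* All atoms have degree 1. For positive [j], [B = j * m] exceeds the slack since [m > k] and
   [s > 0]; so [j = 0] and the size is [q + 2]. *)
have := H3 eA; case: j Ej Bj => [|j] Ej Bj; nia.
Qed.

Lemma witness_lower_bound N :
  all_chain_connected S ((q + 2) * m, k * q + 2) N -> q + 2 <= N.
Proof.
pose l := nseq q (m, k) ++ nseq 2 (m, 1).
have Hl : factorization S ((q + 2) * m, k * q + 2) (seq_mset l).
  apply: factorization_seq.
    move=> x; rewrite mem_cat !mem_nseq => /orP[/andP[_ /eqP ->]|/andP[_ /eqP ->]].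
      exact: atom_degree1.
    exact: atom_degree1.
  by rewrite sum_pairE !big_cat !big_nseq !iter_addn /=; congr pair; lia.
have n0 : 0 < k * q + 1 by lia.
have [t [att Et]] := leamer_factorization (leamer_large 0 (leqnn q) n0).
have st : size t <= q.
  have [C [D [EC [tC _]]]] := sum_atoms_rep att.
  rewrite sum_pairE in Et; case: Et => Et _; rewrite Et in EC.
  have m0 : 0 < m by have := m_gt1; lia.
  by have [j [-> _]] := arith_rep_uniq m0 EC; lia.
(* This has length at most [q + 1], hence at most 2 by [witness_lengths]. *)
have Ht : factorization S ((q + 2) * m, k * q + 2) (seq_mset ((2 * m, 1) :: t)).
  apply: factorization_seq.
    move=> x; rewrite inE => /orP[/eqP ->|/att //].
    apply: atom_height1; rewrite -[2 * m]addn0 -[X in _ + X](mul0n s).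
    by apply: leamer_interval => //; nia.
  by rewrite big_cons Et; congr pair; rewrite /= /GRing.add /=; nia.
apply: (catenary_lower_bound leamerD _ pair_addI Hl _ _ Ht _ witness_lengths).
- by move=> x y _ _; apply: pair_add_eq0.
- by rewrite size_seq_mset size_cat !size_nseq.
- by have := q_gt0; lia.
- by rewrite size_seq_mset /=; lia.
Qed.

Lemma arith_leamer_catenary_degree : catenary_degree S (q + 2).
Proof.
split=> [a _|b Hb].
  apply: elt_catenary_degree_exists; apply: all_chain_connected_shorten.
  exact: leamer_shorten.
have Sw : S ((q + 2) * m, k * q + 2).
  have := @leamer_large (q + 2) 0 (k * q + 2); rewrite mul0n addn0; apply; lia.
by have [c [/witness_lower_bound qc _]] := Hb _ Sw; apply: leq_trans.
Qed.

End ArithmeticalLeamer.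

Theorem corollary4p6 (m k s : nat) (hk : 1 <= k) (hkm : k <= m - 1)
    (hms : gcdn m s = 1) :
  catenary_degree (arith_leamer m k s) ((m - 2) %/ k + 3).
Proof.
rewrite addn3 -(addn2 _.+1).
have E := divn_eq (m - 2) k; have := ltn_pmod (m - 2) hk => r.
(* Division of [m - 2] by [k] gives both conditions on [q = (m - 2) %/ k + 1]: the remainder is less
   than [k] for [q_ge] and nonnegative for [q_min]. *)
by apply: arith_leamer_catenary_degree => // [|a]; nia.
Qed.
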